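(* Let $n\ge 2$. For most pairs $(K,L)\in(\mathcal{K}^n)^2$ the following holds: the bodies $K$ and $L$ are strictly convex, and for most $u\in\mathbb{S}^{n-1}$, for most $t\in T_u$, the reverse Gauss map $x_{K,L}$ of $(K,L)$ makes a turn at $u$ in direction $t$. (Here the first ''most'' refers to the space $(\mathcal{K}^n)^2$, the second to the space $\mathbb{S}^{n-1}$, and the third to the space $T_u$.)
   Context: $\mathcal{K}^n$ is the set of convex bodies (nonempty, compact, convex subsets) of $\mathbb{R}^n$, with the Hausdorff metric $\delta$. $(\mathcal{K}^n)^2$ carries the metric $d((K,L),(K',L'))=\delta(K,K')+\delta(L,L')$. $\mathbb{S}^{n-1}$ is the Euclidean unit sphere of $\mathbb{R}^n$, and for $u\in\mathbb{S}^{n-1}$, $T_u=\{t\in\mathbb{S}^{n-1}:\langle t,u\rangle=0\}$; both carry their natural (subspace) topologies. All these spaces are Baire spaces. A subset of a Baire space $X$ is meager if it is a countable union of nowhere dense sets, and comeager if its complement is meager. ''Most elements of $X$ have property $P$'' means that the set of all elements of $X$ with property $P$ is comeager in $X$. A convex body is strictly convex if its boundary contains no nondegenerate segment. For a strictly convex body $K$ and $u\in\mathbb{S}^{n-1}$, $x_K(u)$ denotes the unique point of $K$ in the supporting hyperplane of $K$ with outer unit normal vector $u$, i.e. the unique $x\in K$ with $\langle x,u\rangle=\max_{y\in K}\langle y,u\rangle$. For strictly convex $K,L$, the reverse Gauss map of the pair $(K,L)$ is the (continuous) map $x_{K,L}:=x_K-x_L:\mathbb{S}^{n-1}\to\mathbb{R}^n$.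 For $u\in\mathbb{S}^{n-1}$, $t\in T_u$, $\lambda\in\mathbb{R}$, put $u\boxplus\lambda t=\dfrac{u+\lambda t}{\|u+\lambda t\|}$. A continuous map $x:\mathbb{S}^{n-1}\to\mathbb{R}^n$ makes a turn at $u\in\mathbb{S}^{n-1}$ in direction $t\in T_u$ if for every $\varepsilon>0$ there are numbers $0<\lambda,\mu<\varepsilon$ such that $$\langle x(u\boxplus\lambda t)-x(u),t\rangle\cdot\langle x(u\boxplus-\mu t)-x(u),t\rangle>0.$$ *)

(* Defs.v *)
From HB Require Import structures.
From mathcomp Require Import all_boot all_order all_algebra.
From mathcomp Require Import all_classical all_reals all_analysis.
From mathcomp Require Import ring lra.
Set Implicit Arguments.
Unset Strict Implicit.
Unset Printing Implicit Defensive.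
Import Order.TTheory GRing.Theory Num.Theory.
Import numFieldNormedType.Exports.
Local Open Scope classical_set_scope.
Local Open Scope ring_scope.

Section category.
Context {X : topologicalType}.

Definition nowhere_dense (A : set X) : Prop := (closure A)° = set0.

Definition meager (A : set X) : Prop :=
  exists F : nat -> set X,
    (forall i, nowhere_dense (F i)) /\ A = \bigcup_i F i.

Definition comeager (A : set X) : Prop := meager (~` A).

Definition most (P : X -> Prop) : Prop := comeager [set x | P x].

Definition boundary (A : set X) : set X := closure A `\` A°.

End category.

Section euclidean.
Context {R : realType} {n : nat}.
Implicit Types x y z : 'rV[R]_n.

Definition dot x y : R := \sum_i x 0 i * y 0 i.

(* The library norm `|x| on 'rV[R]_n is the max norm; it induces the same
   topology as the Euclidean norm below, but not the same distances. *)
Definition enorm x : R := Num.sqrt (dot x x).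

Lemma dotC x y : dot x y = dot y x.
Proof. by apply: eq_bigr => i _; rewrite mulrC. Qed.

Lemma dotDl x y z : dot (x + y) z = dot x z + dot y z.
Proof. by rewrite /dot -big_split; apply: eq_bigr => i _; rewrite mxE mulrDl. Qed.

Lemma dotZl (a : R) x y : dot (a *: x) y = a * dot x y.
Proof. by rewrite /dot mulr_sumr; apply: eq_bigr => i _; rewrite mxE mulrA. Qed.

Lemma dotDr x y z : dot x (y + z) = dot x y + dot x z.
Proof. by rewrite dotC dotDl !(dotC x). Qed.

Lemma dotZr (a : R) x y : dot x (a *: y) = a * dot x y.
Proof. by rewrite dotC dotZl dotC. Qed.

Lemma dot_ge0 x : 0 <= dot x x.
Proof. by apply: sumr_ge0 => i _; rewrite -expr2 sqr_ge0. Qed.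

Lemma enorm_ge0 x : 0 <= enorm x. Proof. exact: sqrtr_ge0. Qed.

Lemma sqr_enorm x : enorm x ^+ 2 = dot x x.
Proof. by rewrite sqr_sqrtr// dot_ge0. Qed.

Lemma enorm0 : enorm 0 = 0.
Proof. by rewrite /enorm /dot big1 ?sqrtr0// => i _; rewrite mxE mul0r. Qed.

Lemma enormZ (a : R) x : enorm (a *: x) = `|a| * enorm x.
Proof.
by rewrite /enorm dotZl dotZr mulrA -expr2 sqrtrM ?sqr_ge0// sqrtr_sqr.
Qed.

Lemma enormN x : enorm (- x) = enorm x.
Proof. by rewrite -scaleN1r enormZ normrN1 mul1r. Qed.

Lemma enorm_sym x y : enorm (x - y) = enorm (y - x).
Proof. by rewrite -enormN opprB. Qed.

Lemma mx_norm_le_enorm x : `|x| <= enorm x.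
Proof.
have h i : `|x 0 i| <= enorm x.
  rewrite -sqrtr_sqr ler_wsqrtr// /dot (bigD1 i)//= -expr2 lerDl.
  by apply: sumr_ge0 => j _; rewrite -expr2 sqr_ge0.
rewrite /Num.Def.normr/= mx_normrE; apply: bigmax_le => [|[i j] _]/=.
  exact: enorm_ge0.
by rewrite (ord1 i).
Qed.

Lemma enorm_eq0 x : enorm x = 0 -> x = 0.
Proof.
by move=> x0; have := mx_norm_le_enorm x; rewrite x0 normr_le0 => /eqP.
Qed.

Lemma dot_le_enorm x y : dot x y <= enorm x * enorm y.
Proof.
have [->|x0] := eqVneq x 0.
  by rewrite enorm0 mul0r -(scale0r 0) dotZl mul0r.
have [->|y0] := eqVneq y 0.
  by rewrite enorm0 mulr0 -(scale0r 0) dotZr mul0r.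
have pos z : z != 0 -> 0 < enorm z.
  move=> z0; rewrite lt_neqAle enorm_ge0 andbT.
  by apply: contra_neq z0 => /esym /enorm_eq0.
have ab : 0 < enorm x * enorm y by rewrite mulr_gt0 ?pos.
have := dot_ge0 (enorm y *: x - enorm x *: y).
rewrite -scaleNr !(dotDl, dotDr, dotZl, dotZr) (dotC y x) -!sqr_enorm.
by move=> h; rewrite -(ler_pM2l ab); nra.
Qed.

Lemma enormD x y : enorm (x + y) <= enorm x + enorm y.
Proof.
rewrite -(ler_pXn2r (_ : 0 < 2)%N)// ?nnegrE ?enorm_ge0 ?addr_ge0 ?enorm_ge0//.
rewrite sqr_enorm !(dotDl, dotDr) (dotC y x) sqrrD !sqr_enorm.
have := dot_le_enorm x y; lra.
Qed.

Lemma enorm_le_mx_norm x : enorm x <= Num.sqrt n%:R * `|x|.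
Proof.
have h i : `|x 0 i| <= `|x|.
  rewrite [leRHS]/Num.Def.normr/= mx_normrE.
  exact: (le_bigmax _ (fun ij : 'I_1 * 'I_n => `|x ij.1 ij.2|) (0, i)).
rewrite -[X in _ * X]ger0_norm// -sqrtr_sqr -sqrtrM ?ler0n// ler_wsqrtr//.
rewrite /dot mulr_natl -[X in _ *+ X]card_ord -sumr_const; apply: ler_sum => i _.
by rewrite -expr2 -real_normK ?num_real// ler_pXn2r// ?nnegrE.
Qed.

End euclidean.

Section bodies.
Context (R : realType) (n : nat).

Record convex_body := ConvexBody {
  carrier : set 'rV[R]_n ;
  carrier_nonempty : carrier !=set0 ;
  carrier_compact : compact carrier ;
  carrier_convex : convex_set (carrier : set (convex_lmodType 'rV[R]_n)) }.

HB.instance Definition _ := gen_eqMixin convex_body.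
HB.instance Definition _ := gen_choiceMixin convex_body.

Implicit Types K L M : convex_body.

Lemma convex_body_eq K L : carrier K = carrier L -> K = L.
Proof.
case: K L => [A a1 a2 a3] [B b1 b2 b3]/= AB; move: a1 a2 a3; rewrite AB.
by move=> a1 a2 a3; congr ConvexBody; exact: Prop_irrelevance.
Qed.

(* A is contained in the Minkowski sum of B and the closed e-ball. *)
Definition in_fattening (A B : set 'rV[R]_n) (e : R) : Prop :=
  forall x, A x -> exists2 y, B y & enorm (x - y) <= e.

Definition fattenings K L : set R :=
  [set e | [/\ 0 <= e, in_fattening (carrier K) (carrier L) e &
    in_fattening (carrier L) (carrier K) e]].

Definition hausdorff_dist K L : R := inf (fattenings K L).

Lemma fattenings_lb K L : has_lbound (fattenings K L).
Proof. by exists 0 => e []. Qed.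

Lemma body_bounded K : exists N : R, forall x, carrier K x -> enorm x <= N.
Proof.
have [M [_ MK]] := compact_bounded (@carrier_compact K).
exists (Num.sqrt n%:R * (M + 1)) => x Kx.
apply: le_trans (enorm_le_mx_norm x) _; apply: ler_wpM2l; first exact: sqrtr_ge0.
by apply: MK => //; rewrite ltrDl.
Qed.

Lemma fattenings_nonempty K L : fattenings K L !=set0.
Proof.
have [a aK] := body_bounded K; have [b bL] := body_bounded L.
have [x0 Kx0] := @carrier_nonempty K; have [y0 Ly0] := @carrier_nonempty L.
have h x y : carrier K x -> carrier L y -> enorm (x - y) <= a + b.
  move=> Kx Ly; apply: le_trans (enormD _ _) _; rewrite enormN.
  by rewrite lerD ?aK ?bL.
exists (a + b); split; first exact: le_trans (enorm_ge0 _) (h _ _ Kx0 Ly0).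
  by move=> x Kx; exists y0 => //; exact: h.
by move=> y Ly; exists x0 => //; rewrite enorm_sym; exact: h.
Qed.

Lemma has_inf_fattenings K L : has_inf (fattenings K L).
Proof. by split; [exact: fattenings_nonempty|exact: fattenings_lb]. Qed.

Lemma hausdorff_distxx K : hausdorff_dist K K = 0.
Proof.
have h : in_fattening (carrier K) (carrier K) 0 by move=> x Kx; exists x => //; rewrite subrr enorm0.
apply/eqP; rewrite eq_le; apply/andP; split.
  by apply: ge_inf; [exact: fattenings_lb|split].
by apply: lb_le_inf; [exact: fattenings_nonempty|move=> e []].
Qed.

Lemma hausdorff_dist_sym K L : hausdorff_dist K L = hausdorff_dist L K.
Proof.
by congr inf; apply/seteqP; split=> e [e0 h1 h2]; split.
Qed.

Lemma hausdorff_dist_positivity K L : hausdorff_dist K L = 0 -> K = L.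
Proof.
wlog suff : K L / hausdorff_dist K L = 0 -> carrier K `<=` carrier L.
  move=> h KL0; apply: convex_body_eq; apply/seteqP; split; first exact: h.
  by apply: h; rewrite hausdorff_dist_sym.
move=> KL0 x Kx.
have /compact_closed cL := @carrier_compact L.
apply: (cL (@norm_hausdorff _ _)) => B /nbhs_ballP[e /= e0 eB].
have [d [_ KLd _]] := inf_adherent e0 (has_inf_fattenings K L).
rewrite -/(hausdorff_dist K L) KL0 add0r => de.
have [y Ly xy] := KLd x Kx; exists y; split => //; apply: eB.
rewrite -ball_normE /=; apply: le_lt_trans (mx_norm_le_enorm _) _.
exact: le_lt_trans xy de.
Qed.

Lemma hausdorff_dist_triangle L K M :
  hausdorff_dist K M <= hausdorff_dist K L + hausdorff_dist L M.
Proof.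
apply/ler_addgt0Pr => e e0; have e20 : 0 < e / 2 by rewrite divr_gt0.
have [a [a0 KLa LKa] ae] := inf_adherent e20 (has_inf_fattenings K L).
have [b [b0 LMb MLb] be] := inf_adherent e20 (has_inf_fattenings L M).
have tr (A B C : set 'rV[R]_n) (c d : R) : in_fattening A B c ->
    in_fattening B C d -> in_fattening A C (c + d).
  move=> AB BC x /AB[y /BC[z Cz yz] xy]; exists z => //.
  by rewrite -(subrKA y) (le_trans (enormD _ _))// lerD.
have : hausdorff_dist K M <= a + b.
  apply: ge_inf; first exact: fattenings_lb.
  by split; [exact: addr_ge0|exact: tr KLa LMb|rewrite addrC; exact: tr MLb LKa].
move: ae be; rewrite -/(hausdorff_dist K L) -/(hausdorff_dist L M); lra.
Qed.

HB.instance Definition _ := @isMetric.Build R convex_body hausdorff_dist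
  hausdorff_distxx hausdorff_dist_positivity hausdorff_dist_sym
  hausdorff_dist_triangle.

(* An alias of the product, so that it carries the sum metric instead of the
   library's max pseudometric on products. *)
Definition body_pair : Type := (convex_body * convex_body)%type.

HB.instance Definition _ := gen_eqMixin body_pair.
HB.instance Definition _ := gen_choiceMixin body_pair.

Definition pair_dist (P Q : body_pair) : R :=
  hausdorff_dist P.1 Q.1 + hausdorff_dist P.2 Q.2.

Lemma hausdorff_dist_ge0 K L : 0 <= hausdorff_dist K L.
Proof. by apply: lb_le_inf; [exact: fattenings_nonempty|move=> e []]. Qed.

Lemma pair_distxx P : pair_dist P P = 0.
Proof. by rewrite /pair_dist !hausdorff_distxx addr0. Qed.

Lemma pair_dist_positivity P Q : pair_dist P Q = 0 -> P = Q.
Proof.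
case: P Q => [K L] [K' L'] /eqP.
rewrite /pair_dist paddr_eq0 ?hausdorff_dist_ge0//= => /andP[/eqP h1 /eqP h2].
by rewrite (hausdorff_dist_positivity h1) (hausdorff_dist_positivity h2).
Qed.

Lemma pair_dist_sym P Q : pair_dist P Q = pair_dist Q P.
Proof. by congr (_ + _); exact: hausdorff_dist_sym. Qed.

Lemma pair_dist_triangle Q P S :
  pair_dist P S <= pair_dist P Q + pair_dist Q S.
Proof. by rewrite addrACA lerD// hausdorff_dist_triangle. Qed.

HB.instance Definition _ := @isMetric.Build R body_pair pair_dist
  pair_distxx pair_dist_positivity pair_dist_sym pair_dist_triangle.

End bodies.

Section turns.
Context {R : realType} {n : nat}.
Implicit Types K L : convex_body R n.

Definition segment (x y : 'rV[R]_n) : set 'rV[R]_n :=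
  [set (1 - s) *: x + s *: y | s in `[0, 1]].

Definition strictly_convex K : Prop :=
  forall x y, x <> y -> ~ segment x y `<=` boundary (carrier K).

(* As a type, [sphere] carries the subtype topology of the library. *)
Definition sphere : set 'rV[R]_n := [set u | enorm u = 1].

Definition tangent (u : sphere) : set sphere :=
  [set t : sphere | dot (\val t) (\val u) = 0].

(* A chosen point of the support set of K in direction u; the support set is
   a singleton when K is strictly convex. *)
Definition support_point K (u : sphere) : 'rV[R]_n :=
  xget 0 [set x | carrier K x /\
    forall y, carrier K y -> dot y (\val u) <= dot x (\val u)].

Definition reverse_gauss K L (u : sphere) : 'rV[R]_n :=
  support_point K u - support_point L u.

Definition boxplus_vec (u t : 'rV[R]_n) (l : R) : 'rV[R]_n :=
  (enorm (u + l *: t))^-1 *: (u + l *: t).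

Lemma boxplus_subproof (u : sphere) (t : tangent u) (l : R) :
  boxplus_vec (\val u) (\val (\val t)) l \in sphere.
Proof.
have uS : dot (\val u) (\val u) = 1 by rewrite -sqr_enorm (set_valP u) expr1n.
have tS : dot (\val (\val t)) (\val (\val t)) = 1.
  by rewrite -sqr_enorm (set_valP (\val t)) expr1n.
have tu : dot (\val (\val t)) (\val u) = 0 := set_valP t.
apply/mem_set; rewrite /sphere /boxplus_vec /= enormZ.
set w := _ + _; have w0 : enorm w != 0.
  rewrite -sqrf_eq0 sqr_enorm !(dotDl, dotDr, dotZl, dotZr).
  by rewrite (dotC (\val u) (\val (\val t))) tu uS tS gt_eqF//; nra.
by rewrite ger0_norm ?invr_ge0 ?enorm_ge0// mulVf.
Qed.

Definition boxplus (u : sphere) (t : tangent u) (l : R) : sphere :=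
  SigSub (boxplus_subproof t l).

Definition makes_turn (x : sphere -> 'rV[R]_n) (u : sphere) (t : tangent u)
    : Prop :=
  forall e : R, 0 < e -> exists l m : R,
    [/\ 0 < l < e, 0 < m < e &
        0 < dot (x (boxplus t l) - x u) (\val (\val t)) *
            dot (x (boxplus t (- m)) - x u) (\val (\val t))].

End turns.

Arguments sphere R n : clear implicits.

(* Main.v *)
Require Import Defs.
From mathcomp Require Import all_boot all_order all_algebra.
From mathcomp Require Import all_classical all_reals all_analysis.
From mathcomp Require Import ring lra.
Import numFieldNormedType.Exports.
Set Implicit Arguments.
Unset Strict Implicit.
Unset Printing Implicit Defensive.
Import Order.TTheory GRing.Theory Num.Theory.
Local Open Scope classical_set_scope.
Local Open Scope ring_scope.

(* Every "most" is reduced to countably many conditions, each of which can be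
   achieved by an arbitrarily small perturbation and then holds in a whole
   neighbourhood. For strict convexity, replace K by a sublevel set of
   d(x, K) + e |x|^2, which is uniformly convex. For turns, fix rational balls
   around u and t and a scale e. Perturb K by adding two spikes, so that its
   support point is the same at u and at u - l t but moves forward at u + l t,
   and perturb L likewise with t replaced by - t. Then x_K - x_L moves forward
   in direction t on both sides of u, and it still does so for all nearby K, L,
   u and t, because the support points concerned are exposed with a linear gap.
   Since the same l serves all nearby u and t, no Kuratowski-Ulam argument is
   needed to order the three quantifiers, nor the continuity of x_K. *)

(** * Countable intersections in Baire category *)

(** [meager] asks for equality with a union, so each nowhere dense piece is cut down to [A]; the
    double index [(i, k)] is coded by one natural number. *)
Lemma meager_bigcup (X : topologicalType) (I : countType) (F : I -> set X)
    (A : set X) :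
  (forall i, meager (F i)) -> A `<=` \bigcup_i F i -> meager A.
Proof.
move=> mF AF.
have [G GP] : {G : I -> nat -> set X | forall i,
    (forall k, nowhere_dense (G i k)) /\ F i = \bigcup_k G i k}.
  by exists (fun i => sval (cid (mF i))) => i; exact: svalP (cid (mF i)).
exists (fun m => if unpickle m is Some (i, k) then G i k `&` A else set0).
split=> [m|].
  case: unpickle => [[i k]|]; last by rewrite /nowhere_dense closure0 interior0.
  apply/seteqP; split => // x; rewrite -((GP i).1 k).
  by apply: interiorS; apply: closureS; exact: subIsetl.
apply/seteqP; split => [x Ax|x [m _]].
  have [i _] := AF x Ax; rewrite (GP i).2 => -[k _ Gx].
  by exists (pickle (i, k)) => //; rewrite pickleK.
by case: unpickle => [[i k] []|].
Qed.

Lemma most_forall (X : topologicalType) (I : countType) (P : I -> X -> Prop) :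
  (forall i, most (P i)) -> most (fun x => forall i, P i x).
Proof.
move=> mP; apply: (@meager_bigcup _ I (fun i => ~` [set x | P i x])) => // x /=.
by move=> /existsNP[i Pi]; exists i.
Qed.

Lemma most_and (X : topologicalType) (P Q : X -> Prop) :
  most P -> most Q -> most (fun x => P x /\ Q x).
Proof.
move=> mP mQ; have := @most_forall X bool (fun b => if b then P else Q).
rewrite /most; set A := [set _ | _]; set B := [set _ | _].
suff -> : A = B by apply; case.
by apply/seteqP; split => x /= => [h|[p q] []//]; split; [exact: (h true)|exact: (h false)].
Qed.

Lemma most_sub (X : topologicalType) (P Q : X -> Prop) :
  (forall x, P x -> Q x) -> most P -> most Q.
Proof.
move=> PQ mP; apply: (@meager_bigcup _ unit (fun=> ~` [set x | P x])) => // x /=.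
by move=> nQ; exists tt => //= /PQ.
Qed.

(** The hypothesis makes the interior of [P] dense, so the complement is itself nowhere dense and a
    constant sequence covers it. *)
Lemma most_dense_open (X : topologicalType) (P : X -> Prop) :
  (forall (x : X) (N : set X), nbhs x N -> exists2 y, N y & nbhs y P) -> most P.
Proof.
move=> h; apply: (@meager_bigcup _ unit (fun=> ~` [set x | P x])); last first.
  by move=> x; exists tt.
move=> _; exists (fun=> ~` [set x | P x]); split; last first.
  by rewrite bigcup_const.
move=> _; apply/seteqP; split => // x /h[y cy yP].
by have [z [/=]] := cy _ yP.
Qed.

(** * Neighbourhoods measured by the Euclidean norm *)

Section nbhs_enorm.
Context (R : realType) (n : nat).
Implicit Types x y u v t : 'rV[R]_n.

Lemma enorm_dist_triangle y x z : enorm (x - z) <= enorm (x - y) + enorm (y - z).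
Proof. by rewrite -(subrKA y) enormD. Qed.

Lemma nbhs_enormP x (A : set 'rV[R]_n) :
  nbhs x A <-> exists2 e, 0 < e & forall y, enorm (y - x) < e -> A y.
Proof.
split=> [/nbhs_ballP[e /= e0 eA]|[e e0 eA]].
  exists e => // y yx; apply: eA; rewrite -ball_normE /= distrC.
  exact: le_lt_trans (mx_norm_le_enorm _) yx.
(* The summand 1 keeps the divisor positive when [n] is 0. *)
have c0 : 0 < Num.sqrt n%:R + 1 :> R by rewrite ltr_wpDl ?sqrtr_ge0.
apply/nbhs_ballP; exists (e / (Num.sqrt n%:R + 1)) => /=; first exact: divr_gt0.
move=> y; rewrite -ball_normE /= distrC ltr_pdivlMr// => yx; apply: eA.
apply: le_lt_trans (enorm_le_mx_norm _) _; apply: le_lt_trans yx.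
by rewrite mulrC ler_wpM2l// lerDl.
Qed.

Lemma nbhs_subtypeP (T : topologicalType) (S : set T) (u : S) (N : set S) :
  nbhs u N <-> exists2 A, nbhs (\val u) A & forall v : S, A (\val v) -> N v.
Proof.
split=> [|[A Au AN]].
  rewrite nbhsE => -[_ [[B oB <-] /= Bu] BN]; exists B.
    by exists B.
  by move=> v Bv; apply: BN.
apply: (@filterS _ (nbhs u) _ (\val @^-1` A)) => //.
exact: (@initial_continuous _ _ (set_val : S -> T)).
Qed.

Lemma nbhs_sphereP (u : sphere R n) (N : set (sphere R n)) :
  nbhs u N <-> exists2 e, 0 < e &
    forall v : sphere R n, enorm (\val v - \val u) < e -> N v.
Proof.
rewrite nbhs_subtypeP; split=> [[A /nbhs_enormP[e e0 eA] AN]|[e e0 eN]].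
  by exists e => // v /eA /AN.
exists [set y | enorm (y - \val u) < e] => //; apply/nbhs_enormP.
by exists e.
Qed.

Lemma nbhs_tangentP (u : sphere R n) (t : tangent u) (N : set (tangent u)) :
  nbhs t N <-> exists2 e, 0 < e &
    forall s : tangent u, enorm (\val (\val s) - \val (\val t)) < e -> N s.
Proof.
rewrite nbhs_subtypeP; split=> [[A /nbhs_sphereP[e e0 eA] AN]|[e e0 eN]].
  by exists e => // v /eA /AN.
exists [set y | enorm (\val y - \val (\val t)) < e] => //; apply/nbhs_sphereP.
by exists e.
Qed.

Lemma nbhs_pairP (P : body_pair R n) (N : set (body_pair R n)) :
  nbhs P N <-> exists2 e, 0 < e & forall Q, pair_dist P Q < e -> N Q.
Proof.
split => [/nbhs_ballP[e /= e0 eN]|[e e0 eN]].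
  by exists e => // Q PQ; apply: eN; rewrite ballEmdist.
by apply/nbhs_ballP; exists e => // Q; rewrite ballEmdist; exact: eN.
Qed.

End nbhs_enorm.

(** * Support points, separation and the Hausdorff distance *)

Section bodies_facts.
Context (R : realType) (n : nat).
Implicit Types (x y z u v w t p q : 'rV[R]_n) (K L : convex_body R n).

Lemma convex_setP (A : set 'rV[R]_n) :
  convex_set (A : set (convex_lmodType 'rV[R]_n)) <->
  forall x y (s : R), A x -> A y -> 0 <= s <= 1 -> A ((1 - s) *: x + s *: y).
Proof.
split=> [cA x y s Ax Ay /andP[s0 s1]|h x y s /set_mem Ax /set_mem Ay].
  rewrite addrC.
  by have /set_mem := cA y x (Itv01 s0 s1) (mem_set Ay) (mem_set Ax).
apply/mem_set; have := h y x s%:num Ay Ax.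
by rewrite ge0 le1 => /(_ isT); rewrite addrC.
Qed.

Lemma carrier_comb K (s : R) x y : carrier K x -> carrier K y ->
  0 <= s <= 1 -> carrier K ((1 - s) *: x + s *: y).
Proof. exact: (@convex_setP _).1 (@carrier_convex _ _ K) x y s. Qed.

Lemma dotNl x y : dot (- x) y = - dot x y.
Proof. by rewrite -scaleN1r dotZl mulN1r. Qed.

Lemma dotNr x y : dot x (- y) = - dot x y.
Proof. by rewrite dotC dotNl dotC. Qed.

Definition dotE := (@dotDl R n, @dotDr R n, dotNl, dotNr, @dotZl R n, @dotZr R n).

Lemma dot_subr_sqr x y : dot (x - y) (x - y) = dot x x - 2 * dot x y + dot y y.
Proof. by rewrite !dotE (dotC y x); ring. Qed.

Lemma lipschitz_continuous (f : 'rV[R]_n -> R) (C : R) :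
  (forall x y, f x - f y <= C * enorm (x - y)) -> continuous f.
Proof.
move=> fC x A /nbhs_ballP[e /= e0 eA]; apply/nbhs_enormP.
have C0 : 0 < `|C| + 1 by rewrite ltr_wpDl.
exists (e / (`|C| + 1)); first exact: divr_gt0.
move=> y; rewrite ltr_pdivlMr// => yx; apply: eA; rewrite -ball_normE /=.
apply: le_lt_trans yx.
have CC : C * enorm (y - x) <= enorm (y - x) * (`|C| + 1).
  rewrite mulrC ler_wpM2l ?enorm_ge0// (le_trans (ler_norm _))//; lra.
have := fC x y; have := fC y x; rewrite (enorm_sym x y) => h1 h2.
by rewrite ler_norml; apply/andP; split; lra.
Qed.

Lemma continuous_dot v : continuous (fun x => dot x v).
Proof.
apply: (@lipschitz_continuous _ (enorm v)) => x y.
by rewrite mulrC -dotNl -dotDl; exact: dot_le_enorm.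
Qed.

Lemma continuous_enorm : continuous (@enorm R n).
Proof.
apply: (@lipschitz_continuous _ 1) => x y.
by rewrite mul1r lerBlDr -{1}(subrK y x) enormD.
Qed.

Lemma support_exists K v :
  exists2 x, carrier K x & forall y, carrier K y -> dot y v <= dot x v.
Proof.
have [|x /set_mem Kx xmax] := @EVT_max_rV R n (fun x => dot x v) (carrier K)
  (@carrier_nonempty _ _ K) (@carrier_compact _ _ K).
  exact/continuous_subspaceT/continuous_dot.
by exists x => // y /mem_set /xmax.
Qed.

(** The normal points to [p] from its nearest point [q] in [K]: no segment from [q] inside [K] may
    come closer to [p]. *)
Lemma separation K p : ~ carrier K p ->
  exists2 v, enorm v = 1 & forall z, carrier K z -> dot z v < dot p v.
Proof.
move=> Kp.
have [|q /set_mem Kq qmin] := @EVT_min_rV R n (fun x => enorm (x - p))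
  (carrier K) (@carrier_nonempty _ _ K) (@carrier_compact _ _ K).
  apply/continuous_subspaceT; apply: (@lipschitz_continuous _ 1) => x y.
  rewrite mul1r lerBlDr (le_trans _ (enormD _ _))//.
  by rewrite [leLHS]/= addrA subrK.
have w0 : p - q != 0 by apply: contra_notN Kp => /eqP /subr0_eq ->.
have ew0 : 0 < enorm (p - q).
  rewrite lt_neqAle enorm_ge0 andbT; apply: contra_neq w0 => /esym.
  exact: enorm_eq0.
have wq z : carrier K z -> dot (z - q) (p - q) <= 0.
  move=> Kz; rewrite leNgt; apply/negP => a0.
  set a := dot _ _ in a0; set b := dot (z - q) (z - q).
  (* Minimality of [q] against [q + s (z - q)], with squares expanded. Taking [s = 1] if [b < a] and
     [s = a / b] otherwise contradicts [a > 0]. *)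
  have key (s : R) : 0 <= s <= 1 -> 2 * s * a <= s ^+ 2 * b.
    move=> s01; have Ks := carrier_comb Kq Kz s01.
    have := qmin _ (mem_set Ks).
    rewrite -ler_sqr ?nnegrE ?enorm_ge0// !sqr_enorm.
    suff -> : (1 - s) *: q + s *: z - p = s *: (z - q) - (p - q).
      rewrite -(opprB p q) dotNl dotNr opprK (dot_subr_sqr (s *: _)).
      by rewrite !(dotZl, dotZr) -/a -/b; lra.
    by apply/rowP => i; rewrite !mxE; ring.
  have b0 : 0 <= b by exact: dot_ge0.
  have [ab|ba] := leP a b; last by have := key 1; rewrite ler01 lexx => /(_ isT); lra.
  have {}b0 : 0 < b by exact: lt_le_trans ab.
  have ab01 : 0 <= a / b <= 1.
    by apply/andP; split; [rewrite divr_ge0 ?ltW|rewrite ler_pdivrMr// mul1r].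
  have := key _ ab01.
  rewrite expr2 -!mulrA mulVf ?gt_eqF// mulr1 (mulrC b^-1) !mulrA.
  have : 0 < a * a / b by rewrite divr_gt0// mulr_gt0.
  lra.
exists ((enorm (p - q))^-1 *: (p - q)).
  by rewrite enormZ ger0_norm ?invr_ge0 ?enorm_ge0// mulVf ?gt_eqF.
move=> z /wq; rewrite !dotZr ltr_pM2l ?invr_gt0// => zq.
have := exprn_gt0 2 ew0; rewrite sqr_enorm.
rewrite !dotE in zq *; lra.
Qed.

Lemma hausdorff_dist_le K L e : 0 <= e -> in_fattening (carrier K) (carrier L) e ->
  in_fattening (carrier L) (carrier K) e -> hausdorff_dist K L <= e.
Proof. by move=> *; apply: ge_inf; [exact: fattenings_lb|split]. Qed.

Lemma hausdorff_dist_lt K L e : hausdorff_dist K L < e ->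
  in_fattening (carrier K) (carrier L) e.
Proof.
move=> KL; have KLe : 0 < e - hausdorff_dist K L by rewrite subr_gt0.
have [d [_ KLd _] dlt] := inf_adherent KLe (has_inf_fattenings K L).
move=> x /KLd[y Ly xy]; exists y => //; apply: le_trans xy _; apply: ltW.
by apply: lt_le_trans dlt _; rewrite -/(hausdorff_dist K L); lra.
Qed.

(** * Density and stability of uniform convexity *)

(* Quantitative strict convexity; unlike strict convexity itself, it survives
   small perturbations of the body at the price of a larger [d]. *)
Definition rotund K (d r : R) := forall x y p, carrier K x -> carrier K y ->
  d <= enorm (x - y) -> enorm (p - 2^-1 *: (x + y)) <= r -> carrier K p.

(** The midpoint of a nondegenerate boundary segment would be an interior point. *)
Lemma rotund_strictly_convex K :
  (forall m : nat, exists2 r, 0 < r & rotund K m.+1%:R^-1 r) ->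
  strictly_convex K.
Proof.
move=> h x y xy sK.
have Kxy s : 0 <= s <= 1 -> boundary (carrier K) ((1 - s) *: x + s *: y).
  by move=> s01; apply: sK; exists s => //=; rewrite in_itv.
have bK z : boundary (carrier K) z -> carrier K z.
  by move=> [+ _]; apply: compact_closed; [exact: norm_hausdorff|exact: carrier_compact].
have Kx : carrier K x.
  by apply: bK; have := Kxy 0; rewrite lexx ler01 subr0 scale1r scale0r addr0; exact.
have Ky : carrier K y.
  by apply: bK; have := Kxy 1; rewrite lexx ler01 subrr scale0r scale1r add0r; exact.
have xy0 : 0 < enorm (x - y).
  by rewrite lt_neqAle enorm_ge0 andbT; apply/eqP => /esym /enorm_eq0 /subr0_eq.
have [m mxy] : exists m, m.+1%:R^-1 < enorm (x - y).
  exists (Num.truncn (enorm (x - y))^-1).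
  by rewrite invf_plt ?posrE// Num.Theory.truncnS_gt.
have [r r0 rK] := h m.
have [] := Kxy 2^-1; first by apply/andP; split; lra.
move=> _; apply; apply/nbhs_enormP; exists r => // p pr.
apply: (rK x y) => //; first exact: ltW.
suff -> : 2^-1 *: (x + y) = (1 - 2^-1) *: x + 2^-1 *: y by exact: ltW.
by rewrite scalerDr; congr (_ *: _ + _); lra.
Qed.

(** If [p] lay outside [L], push it by [e] along a separating normal. It stays within [r] of the
    midpoint of two points of [K] near [x] and [y], so it lies in [K], yet its distance from every
    point of [L] exceeds [e]. *)
Lemma rotund_perturb K d r : 0 < d -> 0 < r -> rotund K (d / 2) r ->
  exists2 e, 0 < e & forall L, hausdorff_dist K L < e -> rotund L d (r / 2).
Proof.
move=> d0 r0 rK.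
(* [r / 4] pays for the push and for the shift of the midpoint, each at most [e]; [d / 4] keeps the
   two points of [K] at distance at least [d / 2]. *)
pose e := Num.min (r / 4) (d / 4).
have e0 : 0 < e by rewrite lt_min !divr_gt0.
have er : e <= r / 4 by rewrite ge_min lexx.
have ed : e <= d / 4 by rewrite ge_min lexx orbT.
exists e => // L KL x y p Lx Ly dxy pr; apply: contrapT => Lp.
have LK : hausdorff_dist L K < e by rewrite hausdorff_dist_sym.
have [x' Kx' xx'] := hausdorff_dist_lt LK Lx.
have [y' Ky' yy'] := hausdorff_dist_lt LK Ly.
have [v v1 vL] := separation Lp.
have Kp : carrier K (p + e *: v).
  apply: (rK x' y') => //.
    have := enorm_dist_triangle x' x y; have := enorm_dist_triangle y' x' y.
    rewrite (enorm_sym y' y); lra.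
  have -> : p + e *: v - 2^-1 *: (x' + y') =
      (p - 2^-1 *: (x + y)) + (e *: v + 2^-1 *: ((x - x') + (y - y'))).
    by apply/rowP => i; rewrite !mxE; ring.
  have := enormD (p - 2^-1 *: (x + y)) (e *: v + 2^-1 *: ((x - x') + (y - y'))).
  have := enormD (e *: v) (2^-1 *: ((x - x') + (y - y'))).
  have := enormD (x - x') (y - y').
  rewrite !enormZ v1 (ger0_norm (ltW e0)) ger0_norm ?invr_ge0//; lra.
have [z Lz] := hausdorff_dist_lt KL Kp.
have := vL z Lz; have := dot_le_enorm (p + e *: v - z) v.
rewrite v1 mulr1 !dotE -(sqr_enorm v) v1 expr1n; lra.
Qed.

Lemma enorm_ball_compact (r : R) : compact [set x : 'rV[R]_n | enorm x <= r].
Proof.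
apply: bounded_closed_compact.
  exists r; split; first exact: num_real.
  by move=> s rs x /= xr; apply: le_trans (mx_norm_le_enorm _) (le_trans xr (ltW rs)).
apply: (@closed_comp _ _ (@enorm R n) [set y | y <= r]); last exact: closed_le.
by move=> x _; exact: continuous_enorm.
Qed.

(* A sublevel set of d(x, A) + e |x|^2, written without an infimum. *)
Definition puffed (A : set 'rV[R]_n) (e c : R) : set 'rV[R]_n :=
  [set x | exists2 z, A z & enorm (x - z) + e * dot x x <= c].

(** The set is the first projection of a compact set of pairs [(x, z)]; the bound on [A] confines
    [x] to the ball of radius [c + r]. *)
Lemma puffed_compact (A : set 'rV[R]_n) (e c : R) : 0 <= e -> compact A ->
  (exists r, forall z, A z -> enorm z <= r) -> compact (puffed A e c).
Proof.
move=> e0 cA [r Ar].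
pose f (w : 'rV[R]_n * 'rV[R]_n) := enorm (w.1 - w.2) + e * (enorm w.1 * enorm w.1).
have cf : continuous f.
  move=> w; apply: cvgD.
    apply: (@continuous_comp _ _ _ (fun w : 'rV[R]_n * 'rV[R]_n => w.1 - w.2) (@enorm R n)).
      by apply: cvgB; [exact: cvg_fst|exact: cvg_snd].
    exact: continuous_enorm.
  have c1 : {for w, continuous (fun w : 'rV[R]_n * 'rV[R]_n => enorm w.1)}.
    apply: (@continuous_comp _ _ _ fst (@enorm R n)); first exact: cvg_fst.
    exact: continuous_enorm.
  by apply: cvgM; [exact: cvg_cst|exact: cvgM].
have cS : compact (([set x : 'rV[R]_n | enorm x <= c + r] `*` A) `&` [set w | f w <= c]).
  apply: compact_closedI; first by apply: compact_setX => //; exact: enorm_ball_compact.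
  apply: (@closed_comp _ _ f [set y | y <= c]); last exact: closed_le.
  by move=> w _; exact: cf.
suff -> : puffed A e c =
    fst @` (([set x : 'rV[R]_n | enorm x <= c + r] `*` A) `&` [set w | f w <= c]).
  apply: continuous_compact cS; apply: continuous_subspaceT => w.
  exact: cvg_fst.
apply/seteqP; split => [x [z Az xz]|_ [[x z] [[/= xr Az] xz] <-]]; last first.
  by exists z => //; move: xz; rewrite /f /= -expr2 sqr_enorm.
exists (x, z) => //; split; last by rewrite /f /= -expr2 sqr_enorm.
split => //=; rewrite -[x](subrK z) (le_trans (enormD _ _))// lerD ?Ar//.
by apply: le_trans xz; rewrite lerDl mulr_ge0// dot_ge0.
Qed.

Lemma dot_convex_comb (s : R) x y :
  dot ((1 - s) *: x + s *: y) ((1 - s) *: x + s *: y) =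
  (1 - s) * dot x x + s * dot y y - s * (1 - s) * dot (x - y) (x - y).
Proof. by rewrite dot_subr_sqr !dotE (dotC y x); ring. Qed.

Lemma enorm_convex_comb (s : R) x y : 0 <= s <= 1 ->
  enorm ((1 - s) *: x + s *: y) <= (1 - s) * enorm x + s * enorm y.
Proof.
move=> /andP[s0 s1]; apply: le_trans (enormD _ _) _.
by rewrite !enormZ !ger0_norm// subr_ge0.
Qed.

(** The squared norm contributes the gain [e s (1 - s) |x - y|^2], which pays for moving from the
    combination to [p]. With [p] equal to the combination this gives convexity, with [p] near a
    midpoint rotundity. *)
Lemma puffed_comb K (e c s : R) x y p : 0 <= e -> 0 <= s <= 1 ->
  puffed (carrier K) e c x -> puffed (carrier K) e c y ->
  enorm (p - ((1 - s) *: x + s *: y)) + e * dot p p <=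
    e * dot ((1 - s) *: x + s *: y) ((1 - s) *: x + s *: y)
      + e * (s * (1 - s) * dot (x - y) (x - y)) ->
  puffed (carrier K) e c p.
Proof.
move=> e0 s01 [z Kz xz] [w Kw yw] pm.
exists ((1 - s) *: z + s *: w).
  exact: carrier_comb.
have := enorm_dist_triangle ((1 - s) *: x + s *: y) p ((1 - s) *: z + s *: w).
have -> : (1 - s) *: x + s *: y - ((1 - s) *: z + s *: w) = (1 - s) *: (x - z) + s *: (y - w).
  by apply/rowP => i; rewrite !mxE; ring.
have := enorm_convex_comb (x - z) (y - w) s01.
move: pm; rewrite dot_convex_comb => pm h1 h2.
have /andP[s0 s1] := s01.
have s1' : 0 <= 1 - s by rewrite subr_ge0.
have := ler_wpM2l s0 yw; have := ler_wpM2l s1' xz; nra.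
Qed.

Lemma rotund_dense K e : 0 < e -> exists2 L, hausdorff_dist K L <= e &
  forall d, 0 < d -> exists2 r, 0 < r & rotund L d r.
Proof.
move=> e0; have [N KN] := body_bounded K.
have [k0 Kk0] := @carrier_nonempty _ _ K.
have N0 : 0 <= N by exact: le_trans (enorm_ge0 _) (KN _ Kk0).
have M0 : 0 < N ^+ 2 + 1 by rewrite ltr_wpDl ?sqr_ge0.
(* This weight keeps the quadratic term at most [e] on [K], so that [K] lies in [S]. *)
pose a := e / (N ^+ 2 + 1).
have a0 : 0 < a by exact: divr_gt0.
have aN : a * N ^+ 2 <= e.
  by rewrite /a -mulrA ger_pMr// mulrC ler_pdivrMr// mul1r lerDl.
have a0' := ltW a0.
pose S := puffed (carrier K) a e.
have KS x : carrier K x -> S x.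
  move=> Kx; exists x => //; rewrite subrr enorm0 add0r -sqr_enorm.
  apply: le_trans aN; rewrite ler_wpM2l// ler_sqr ?nnegrE ?enorm_ge0//; exact: KN.
have SK x : S x -> exists2 z, carrier K z & enorm (x - z) <= e.
  move=> [z Kz xz]; exists z => //; apply: le_trans xz.
  by rewrite lerDl mulr_ge0 ?dot_ge0.
have cS : compact S.
  by apply: puffed_compact => //; [exact: carrier_compact|exists N].
have vS : convex_set (S : set (convex_lmodType 'rV[R]_n)).
  apply/convex_setP => x y s Sx Sy s01.
  apply: (puffed_comb a0' s01 Sx Sy); rewrite subrr enorm0 add0r lerDl.
  have /andP[s0 s1] := s01.
  apply: mulr_ge0 => //; apply: mulr_ge0; last exact: dot_ge0.
  by rewrite mulr_ge0 ?subr_ge0.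
exists (ConvexBody (ex_intro _ _ (KS _ Kk0)) cS vS).
  apply: hausdorff_dist_le => //=; first exact: ltW.
  by move=> x Kx; exists x; [exact: KS|rewrite subrr enorm0 ltW].
move=> d d0.
pose M := e + N.
have SM x : S x -> enorm x <= M.
  move=> /SK[z Kz xz]; rewrite -[x](subrK z) (le_trans (enormD _ _))// lerD//.
  exact: KN.
have M0' : 0 <= M by rewrite /M addr_ge0// ltW.
have D0 : 0 < 4 * (1 + a * (2 * M + 1)).
  by rewrite mulr_gt0// ltr_wpDr ?ltr01// mulr_ge0//; lra.
(* Moving by [r] from the midpoint costs at most [r (1 + a (2 M + 1))], to be covered by the gain
   [a d^2 / 4]; [r <= 1] bounds [r^2] by [r]. *)
pose r := Num.min 1 (a * d ^+ 2 / (4 * (1 + a * (2 * M + 1)))).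
have r0 : 0 < r by rewrite lt_min ltr01 divr_gt0// mulr_gt0// exprn_gt0.
have r1 : r <= 1 by rewrite ge_min lexx.
have rd : r * (4 * (1 + a * (2 * M + 1))) <= a * d ^+ 2.
  by rewrite -ler_pdivlMr// ge_min lexx orbT.
exists r => // x y p /= Sx Sy dxy.
have hE : 2^-1 *: (x + y) = (1 - 2^-1) *: x + 2^-1 *: y.
  by rewrite scalerDr; congr (_ *: _ + _); lra.
have h01 : 0 <= (2^-1 : R) <= 1 by apply/andP; split; lra.
have half : 1 - 2^-1 = 2^-1 :> R by lra.
rewrite hE; set m := (_ *: x + _) => pm.
have mM : enorm m <= M.
  have := enorm_convex_comb x y h01; have := SM x Sx; have := SM y Sy.
  rewrite -/m half; lra.
have pm2 : enorm p <= enorm m + r.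
  by have := enormD (p - m) m; rewrite subrK; lra.
apply: (puffed_comb a0' h01 Sx Sy); rewrite -/m -!sqr_enorm half.
have d2 : d ^+ 2 <= enorm (x - y) ^+ 2 by rewrite ler_sqr ?nnegrE ?enorm_ge0// ltW.
have p2 : enorm p ^+ 2 <= (enorm m + r) ^+ 2.
  by rewrite ler_sqr ?nnegrE ?enorm_ge0// addr_ge0 ?enorm_ge0// ltW.
have k1 : enorm p ^+ 2 <= enorm m ^+ 2 + r * (2 * M + 1).
  apply: le_trans p2 _; have := enorm_ge0 m; nra.
have k2 := ler_wpM2l a0' k1; have k3 := ler_wpM2l a0' d2.
lra.
Qed.

(** * Cones over convex bodies *)

(** For nonempty convex [A] this is the convex hull of [A] and [q]; it serves to grow a spike. *)
Definition cone (A : set 'rV[R]_n) q : set 'rV[R]_n :=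
  [set y | exists x (s : R), [/\ A x, 0 <= s <= 1 & y = (1 - s) *: x + s *: q]].

Lemma cone_sub A q : A `<=` cone A q.
Proof.
move=> x Ax; exists x, 0; split => //; first by rewrite lexx ler01.
by rewrite subr0 scale1r scale0r addr0.
Qed.

Lemma cone_apex A q : A !=set0 -> cone A q q.
Proof.
move=> [x Ax]; exists x, 1; split => //; first by rewrite lexx ler01.
by rewrite subrr scale1r scale0r add0r.
Qed.

Lemma cone_compact A q : compact A -> compact (cone A q).
Proof.
move=> cA.
pose f (w : 'rV[R]_n * R^o) : 'rV[R]_n := (1 - w.2) *: w.1 + w.2 *: q.
have cf : continuous f.
  move=> w; apply: cvgD; apply: cvgZ.
  - by apply: cvgB; [exact: cvg_cst|exact: cvg_snd].
  - exact: cvg_fst.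
  - exact: cvg_snd.
  - exact: cvg_cst.
suff -> : cone A q = f @` (A `*` `[0, 1]%classic).
  apply: continuous_compact; first exact: continuous_subspaceT.
  by apply: compact_setX => //; exact: segment_compact.
apply/seteqP; split => [_ [x [s [Ax s01 ->]]]|_ [[x s] [/= Ax s01] <-]].
  by exists (x, s) => //; split => //=; rewrite in_itv.
by exists x, s; split => //; move: s01; rewrite in_itv.
Qed.

Lemma cone_convex A q : convex_set (A : set (convex_lmodType 'rV[R]_n)) ->
  convex_set (cone A q : set (convex_lmodType 'rV[R]_n)).
Proof.
move=> /convex_setP cA; apply/convex_setP.
move=> _ _ r [x [s [Ax /andP[s0 s1] ->]]] [y [s' [Ay /andP[s'0 s'1] ->]]] /andP[r0 r1].
pose a := (1 - r) * (1 - s); pose b := r * (1 - s').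
have a0 : 0 <= a by rewrite mulr_ge0 ?subr_ge0.
have b0 : 0 <= b by rewrite mulr_ge0 ?subr_ge0.
have ab1 : a + b <= 1 by rewrite /a /b; nra.
have abq : 1 - (a + b) = (1 - r) * s + r * s' by rewrite /a /b; ring.
(* The weights on [A] merge into one point [z] of weight [a + b], and the rest sits on [q]. If
   [a + b] is 0, any point of [A] will do. *)
suff [z Az zE] : exists2 z, A z & (a + b) *: z = a *: x + b *: y.
  exists z, (1 - (a + b)); split => //; first by apply/andP; split; lra.
  rewrite subKr zE abq.
  by apply/rowP => i; rewrite !mxE /a /b; ring.
have [ab0|ab0] := eqVneq (a + b) 0.
  exists x => //; have [-> ->] : a = 0 /\ b = 0 by split; lra.
  by rewrite addr0 !scale0r addr0.
have abp : 0 < a + b by rewrite lt_neqAle eq_sym ab0 addr_ge0.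
exists ((1 - b / (a + b)) *: x + (b / (a + b)) *: y).
  apply: cA => //; apply/andP; split; first by rewrite divr_ge0// ltW.
  by rewrite ler_pdivrMr// mul1r lerDr.
by apply/rowP => i; rewrite !mxE; field.
Qed.

Definition body_cone K q : convex_body R n :=
  ConvexBody (ex_intro _ _ (cone_apex q (@carrier_nonempty _ _ K)))
    (cone_compact (@carrier_compact _ _ K)) (cone_convex (@carrier_convex _ _ K)).

Lemma hausdorff_dist_cone K p q : carrier K p ->
  hausdorff_dist K (body_cone K q) <= enorm (q - p).
Proof.
move=> Kp; apply: hausdorff_dist_le; first exact: enorm_ge0.
  by move=> x Kx; exists x; [exact: cone_sub|rewrite subrr enorm0 enorm_ge0].
move=> _ [x [s [Kx s01 ->]]]; exists ((1 - s) *: x + s *: p).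
  exact: carrier_comb.
have -> : (1 - s) *: x + s *: q - ((1 - s) *: x + s *: p) = s *: (q - p).
  by apply/rowP => i; rewrite !mxE; ring.
have /andP[s0 s1] := s01.
by rewrite enormZ ger0_norm// ler_piMl// enorm_ge0.
Qed.

(** * Exposed points and their stability *)

Definition supports K v x :=
  carrier K x /\ forall y, carrier K y -> dot y v <= dot x v.

(* The linear growth of [dot q v - dot y v] in the distance from [q] is what
   makes support points nearby stable under perturbation of both the body and
   the direction, without any compactness argument. *)
Definition exposed K v q := carrier K q /\ exists2 C, 0 <= C &
  forall y, carrier K y -> enorm (y - q) <= C * (dot q v - dot y v).

(** On a segment from [K] to the apex, distance and gap both scale by [1 - s], so a bound on [K],
    where the gap is at least [g], suffices. *)
Lemma exposed_cone_apex K v q :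
  (forall y, carrier K y -> dot y v < dot q v) -> exposed (body_cone K q) v q.
Proof.
move=> Kq; split; first exact: cone_apex (@carrier_nonempty _ _ K).
have [x0 Kx0 x0max] := support_exists K v; have [N KN] := body_bounded K.
pose g := dot q v - dot x0 v; have g0 : 0 < g by rewrite subr_gt0 Kq.
have D0 : 0 <= N + enorm q.
  by rewrite addr_ge0 ?enorm_ge0// (le_trans (enorm_ge0 _) (KN _ Kx0)).
exists ((N + enorm q) / g); first by rewrite divr_ge0// ltW.
move=> _ [x [s [Kx /andP[s0 s1] ->]]].
have -> : (1 - s) *: x + s *: q - q = (1 - s) *: (x - q).
  by apply/rowP => i; rewrite !mxE; ring.
rewrite enormZ ger0_norm ?subr_ge0//.
have -> : dot q v - dot ((1 - s) *: x + s *: q) v = (1 - s) * (dot q v - dot x v).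
  by rewrite !dotE; ring.
rewrite mulrCA ler_wpM2l ?subr_ge0//.
have h1 : enorm (x - q) <= N + enorm q.
  by rewrite (le_trans (enormD _ _))// enormN lerD2r KN.
apply: le_trans h1 _; rewrite mulrAC ler_pdivlMr// ler_wpM2l//.
by rewrite lerD2l lerN2 x0max.
Qed.

(** The gap is a convex combination of the gaps at [x] and [q'], and the distance is at most the
    same combination of distances; [C] handles the first, [C'] the second. *)
Lemma exposed_cone K v q q' :
  exposed K v q -> dot q' v < dot q v -> exposed (body_cone K q') v q.
Proof.
move=> [Kq [C C0 KC]] q'q; split; first exact: cone_sub.
have g0 : 0 < dot q v - dot q' v by rewrite subr_gt0.
pose C' := enorm (q' - q) / (dot q v - dot q' v).
have C'0 : 0 <= C' by rewrite divr_ge0 ?enorm_ge0// ltW.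
exists (C + C'); first exact: addr_ge0.
move=> _ [x [s [Kx /andP[s0 s1] ->]]].
have -> : (1 - s) *: x + s *: q' - q = (1 - s) *: (x - q) + s *: (q' - q).
  by apply/rowP => i; rewrite !mxE; ring.
apply: le_trans (enormD _ _) _.
rewrite !enormZ !ger0_norm ?subr_ge0//.
have -> : dot q v - dot ((1 - s) *: x + s *: q') v =
    (1 - s) * (dot q v - dot x v) + s * (dot q v - dot q' v).
  by rewrite !dotE; ring.
have xq : 0 <= dot q v - dot x v.
  (* If [C] is 0 then [x] equals [q]; otherwise the gap is nonnegative because [C] times it bounds a
     norm. *)
  have [CE|C1] := eqVneq C 0.
    have := KC _ Kx; rewrite CE mul0r => xq.
    have /enorm_eq0/subr0_eq -> : enorm (x - q) = 0; last by rewrite subrr.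
    by apply/eqP; rewrite eq_le xq enorm_ge0.
  have := le_trans (enorm_ge0 _) (KC _ Kx).
  by rewrite pmulr_rge0// lt_neqAle eq_sym C1.
have s1' : 0 <= 1 - s by rewrite subr_ge0.
have h1 := ler_wpM2l s1' (KC _ Kx).
have h2 : enorm (q' - q) = C' * (dot q v - dot q' v) by rewrite /C' divfK// gt_eqF.
have h3 : 0 <= (1 - s) * (C' * (dot q v - dot x v)).
  by apply: mulr_ge0 => //; exact: mulr_ge0.
have h4 : 0 <= s * (C * (dot q v - dot q' v)).
  by apply: mulr_ge0 => //; apply: mulr_ge0 => //; exact: ltW.
rewrite {1}h2; lra.
Qed.

(** Take [y] in [K] near [x] and [z] in [L] near [q]. As [x] maximizes over [L] in direction [w],
    the gap of [y] in direction [v] is small up to [d |y - q|], and the linear gap absorbs this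
    term. *)
Lemma exposed_stable K v q e : exposed K v q -> 0 < e ->
  exists2 d, 0 < d & forall L w x, hausdorff_dist K L < d -> enorm (w - v) < d ->
    supports L w x -> enorm (x - q) < e.
Proof.
move=> [Kq [C C0 KC]] e0.
pose T := 1 + 4 * C * (enorm v + 1).
have v0 := enorm_ge0 v.
have T0 : 0 < T by rewrite /T ltr_wpDr// mulr_ge0//; lra.
(* The second bound gives [C d <= 1 / 2], for the absorption; [T] collects the remaining errors, so
   that [x] ends within [d T <= e / 2] of [q]. *)
pose d := Num.min 1 (Num.min (2 * (C + 1))^-1 (e / (2 * T))).
have C20 : 0 < 2 * (C + 1) by lra.
have d0 : 0 < d by rewrite !lt_min ltr01 invr_gt0 divr_gt0 ?mulr_gt0 //; lra.
have d1 : d <= 1 by rewrite !ge_min lexx.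
have dC : d * (2 * (C + 1)) <= 1.
  by rewrite -ler_pdivlMr// mul1r !ge_min lexx orbT.
have dT : d * (2 * T) <= e.
  by rewrite -ler_pdivlMr ?mulr_gt0// !ge_min lexx !orbT.
exists d => // L w x KL wv [Lx xmax].
have LK : hausdorff_dist L K < d by rewrite hausdorff_dist_sym.
have [y Ky xy] := hausdorff_dist_lt LK Lx.
have [z Lz qz] := hausdorff_dist_lt KL Kq.
have yq := KC _ Ky.
have gapE : dot q v - dot y v =
    dot (q - z) v + (dot (z - x) w + dot (z - x) (v - w)) + dot (x - y) v.
  by rewrite !dotE; ring.
have h1 := dot_le_enorm (q - z) v; have h2 := dot_le_enorm (x - y) v.
have h3 := dot_le_enorm (z - x) (v - w).
have h4 : dot (z - x) w <= 0 by rewrite !dotE subr_le0 xmax.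
rewrite (enorm_sym v w) in h3.
have a0 := enorm_ge0 (y - q); have b0 := enorm_ge0 (z - x).
have h5 : enorm (z - x) <= 2 * d + enorm (y - q).
  have := enorm_dist_triangle q z x; have := enorm_dist_triangle y q x.
  rewrite (enorm_sym z q) (enorm_sym q y) (enorm_sym y x); lra.
have h6 : enorm (q - z) * enorm v <= d * enorm v by rewrite ler_wpM2r.
have h7 : enorm (x - y) * enorm v <= d * enorm v by rewrite ler_wpM2r.
have h8 : enorm (z - x) * enorm (w - v) <= (2 * d + enorm (y - q)) * d.
  by rewrite ler_pM ?enorm_ge0// ltW.
have h9 : dot q v - dot y v <= 2 * d * enorm v + (2 * d + enorm (y - q)) * d.
  rewrite gapE; lra.
have h10 := le_trans yq (ler_wpM2l C0 h9).
have h11 : C * d * enorm (y - q) <= 2^-1 * enorm (y - q).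
  by rewrite ler_wpM2r//; lra.
have h12 : C * d * d <= C * d by rewrite ler_piMr// mulr_ge0// ltW.
have h13 : enorm (y - q) <= d * (T - 1) by rewrite /T; lra.
have := enorm_dist_triangle y x q; have := mulr_gt0 d0 T0; lra.
Qed.

(** * Spikes that move a support point *)

(** A first apex [q] above a support point of [K] dominates [K] in all directions near [u]. A second
    apex [q'], ahead of [q] along [t] but slightly lower along [u], takes over at tilt [l] and not
    at tilts [a <= 0]. *)
Lemma spike K u t e : enorm u = 1 -> enorm t = 1 -> dot t u = 0 -> 0 < e ->
  exists2 l0, 0 < l0 & forall l, 0 < l < l0 -> exists L q q',
    [/\ hausdorff_dist K L <= e, 0 < dot (q' - q) t,
      exposed L (u + l *: t) q' &
      forall a, - l <= a <= 0 -> exposed L (u + a *: t) q].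
Proof.
move=> u1 t1 tu e0.
have uu : dot u u = 1 by rewrite -sqr_enorm u1 expr1n.
have tt : dot t t = 1 by rewrite -sqr_enorm t1 expr1n.
have ut : dot u t = 0 by rewrite dotC.
have [p Kp pmax] := support_exists K u; have [N KN] := body_bounded K.
pose d := e / 4; have d0 : 0 < d by rewrite divr_gt0.
pose q := p + d *: u.
have D0 : 0 < N + enorm q + 1.
  by have := le_trans (enorm_ge0 _) (KN _ Kp); have := enorm_ge0 q; lra.
(* Below the second bound, tilting [u] costs [q] less than its advantage [d] over [K]. *)
pose l0 := Num.min 1 (d / (N + enorm q + 1)).
have l00 : 0 < l0 by rewrite lt_min ltr01 divr_gt0.
have Kq a : `|a| < l0 -> forall y, carrier K y -> dot y (u + a *: t) < dot q (u + a *: t).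
  move=> al y Ky.
  have h1 : dot q u = dot p u + d by rewrite !dotE uu mulr1.
  have h2 := pmax _ Ky.
  have h3 : `|a| * (N + enorm q + 1) < d.
    by rewrite -ltr_pdivlMr//; apply: lt_le_trans al _; rewrite ge_min lexx orbT.
  have h4 : dot (y - q) (a *: t) <= `|a| * (N + enorm q + 1).
    apply: le_trans (dot_le_enorm _ _) _; rewrite enormZ t1 mulr1 mulrC.
    rewrite ler_wpM2l// (le_trans (enormD _ _))// enormN.
    by have := KN _ Ky; lra.
  by move: h4; rewrite dotDl dotNl !(dotDr _ u); lra.
exists l0 => // l /andP[l_gt0 ll0].
have l1 : l < 1 by apply: lt_le_trans ll0 _; rewrite ge_min lexx.
(* In direction [u + a t], [q'] exceeds [q] by [d (a - l / 2)], which is positive at [a = l] and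
   negative for [a <= 0]. *)
pose q' := q + (d *: t - (d * l / 2) *: u).
have q'q a : dot q' (u + a *: t) = dot q (u + a *: t) + (a * d - d * l / 2).
  by rewrite dotDl !dotE uu tt ut tu; ring.
have dl : 0 < d * l by exact: mulr_gt0.
exists (body_cone (body_cone K q) q'), q, q'; split.
- apply: le_trans (hausdorff_dist_triangle (body_cone K q) _ _) _.
  have h1 := hausdorff_dist_cone q Kp.
  have Cq : carrier (body_cone K q) q by exact/cone_apex/carrier_nonempty.
  have h2 := hausdorff_dist_cone q' Cq.
  have h3 : enorm (q - p) <= d by rewrite /q addrC addKr enormZ u1 gtr0_norm// mulr1.
  have h4 : enorm (q' - q) <= 2 * d.
    rewrite /q' (addrC q) addrK (le_trans (enormD _ _))// enormN !enormZ u1 t1.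
    rewrite !gtr0_norm//; nra.
  by move: h1 h2 h3 h4; rewrite /d; lra.
- rewrite /q' (addrC q) addrK !dotE tt ut; lra.
- apply: exposed_cone_apex => _ [x [s [Kx /andP[s0 s1] ->]]].
  have := Kq l; rewrite gtr0_norm// => /(_ ll0 _ Kx) h.
  rewrite q'q dotDl !(dotZl _ _ (u + l *: t)).
  have : 0 <= (1 - s) * (dot q (u + l *: t) - dot x (u + l *: t)).
    by rewrite mulr_ge0 ?subr_ge0// ltW.
  lra.
- move=> a /andP[la a0]; apply: exposed_cone.
    apply: exposed_cone_apex; apply: Kq.
    by rewrite ler0_norm//; lra.
  have := mulr_le0_ge0 a0 (ltW d0).
  by rewrite q'q; lra.
Qed.

End bodies_facts.

(** * Turns that persist near a perturbed pair *)

Section turning_pairs.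
Context (R : realType) (n : nat).
Implicit Types (K L : convex_body R n) (P Q : body_pair R n) (e r : R).

(** One scale of [makes_turn]; the scales [1 / (k + 1)] reduce a turn to countably many
    conditions. *)
Definition turns_within (f : sphere R n -> 'rV[R]_n) e (u : sphere R n)
    (t : tangent u) :=
  exists l m : R, [/\ 0 < l < e, 0 < m < e &
    0 < dot (f (boxplus t l) - f u) (\val (\val t)) *
        dot (f (boxplus t (- m)) - f u) (\val (\val t))].

Lemma tangentP (u : sphere R n) (t : tangent u) :
  [/\ enorm (\val u) = 1, enorm (\val (\val t)) = 1 &
      dot (\val (\val t)) (\val u) = 0].
Proof.
by split; [exact: (set_valP u)|exact: (set_valP (\val t))|exact: (set_valP t)].
Qed.

Lemma tangent_ex (u : sphere R n) (v : 'rV[R]_n) : enorm v = 1 ->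
  dot v (\val u) = 0 -> exists t : tangent u, \val (\val t) = v.
Proof.
move=> v1 vu; pose s : sphere R n := SigSub (mem_set (v1 : sphere R n v)).
by exists (SigSub (mem_set (vu : tangent u s))).
Qed.

(** Compactness makes the support set nonempty, so the default value 0 is never taken. *)
Lemma support_pointP K (u : sphere R n) :
  supports K (\val u) (support_point K u).
Proof.
rewrite /support_point; have [x Kx xmax] := support_exists K (\val u).
exact: (@xgetPex _ 0 [set x | supports K (\val u) x] (ex_intro _ x (conj Kx xmax))).
Qed.

Lemma supports_scale K (c : R) (v x : 'rV[R]_n) : 0 < c ->
  supports K (c *: v) x -> supports K v x.
Proof.
move=> c0 [Kx xmax]; split => // y /xmax.
by rewrite !dotZr ler_pM2l.
Qed.

Lemma support_point_boxplus K (u : sphere R n) (t : tangent u) (l : R) :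
  supports K (\val u + l *: \val (\val t)) (support_point K (boxplus t l)).
Proof.
have /mem_set/set_mem := support_pointP K (boxplus t l).
apply: supports_scale; rewrite invr_gt0 lt_neqAle enorm_ge0 andbT eq_sym.
apply/eqP => w0; have := set_valP (boxplus t l).
by rewrite /sphere /= /boxplus_vec w0 invr0 scale0r enorm0 => /esym/eqP; rewrite oner_eq0.
Qed.

Lemma dot_gt0_stable (w t0 : 'rV[R]_n) : 0 < dot w t0 ->
  exists2 r, 0 < r & forall v t, enorm (v - w) < r -> enorm (t - t0) < r ->
    enorm t = 1 -> 0 < dot v t.
Proof.
move=> a0; have w0 := enorm_ge0 w.
have D0 : 0 < enorm w + 1 by lra.
(* The two error terms stay below [|w| r + r], which is [<w, t0>]. *)
exists (dot w t0 / (enorm w + 1)); first exact: divr_gt0.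
move=> v t; set r := _ / _ => vw tt0 t1.
have rE : r * (enorm w + 1) = dot w t0 by rewrite /r divfK// gt_eqF.
have -> : dot v t = dot w t0 - dot w (t0 - t) - dot (w - v) t.
  by rewrite !dotE; ring.
have := dot_le_enorm w (t0 - t); have := dot_le_enorm (w - v) t.
rewrite t1 (enorm_sym w) (enorm_sym t0).
have : enorm w * enorm (t - t0) <= enorm w * r by rewrite ler_wpM2l// ltW.
lra.
Qed.

(* The perturbed body has, robustly in the body, [u] and [t], a jump of its
   support points ahead of [u] in direction [t] and none behind. *)
Lemma one_sided_jump K (u0 t0 : 'rV[R]_n) e :
  enorm u0 = 1 -> enorm t0 = 1 -> dot t0 u0 = 0 -> 0 < e ->
  exists2 l0, 0 < l0 & forall l, 0 < l < l0 -> exists L w,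
    [/\ hausdorff_dist K L <= e, 0 < dot w t0 &
      forall r, 0 < r -> exists2 d, 0 < d & forall M u t x xp xm,
        hausdorff_dist L M < d -> enorm (u - u0) < d -> enorm (t - t0) < d ->
        supports M u x -> supports M (u + l *: t) xp ->
        supports M (u - l *: t) xm ->
        enorm (xp - x - w) < r /\ enorm (xm - x) < r].
Proof.
move=> u1 t1 tu e0; have [l0 l00 h] := spike K u1 t1 tu e0.
exists l0 => // l ll0; have /andP[l_gt0 _] := ll0.
have [L [q [q' [KL q'q Lq' Lq]]]] := h l ll0.
exists L, (q' - q); split => // r r0; have r20 : 0 < r / 2 by rewrite divr_gt0.
have Lq0 : exposed L u0 q.
  by have := Lq 0; rewrite scale0r addr0; apply; apply/andP; split; lra.
have Lqm : exposed L (u0 - l *: t0) q.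
  by rewrite -scaleNr; apply: Lq; apply/andP; split; lra.
have [d0 d00 h0] := exposed_stable Lq0 r20.
have [dp dp0 hp] := exposed_stable Lq' r20.
have [dm dm0 hm] := exposed_stable Lqm r20.
pose d := Num.min d0 (Num.min (dp / (1 + l)) (dm / (1 + l))).
have l1 : 0 < 1 + l by lra.
have dd0 : d <= d0 by rewrite ge_min lexx.
have ddp : d * (1 + l) <= dp by rewrite -ler_pdivlMr// !ge_min lexx orbT.
have ddm : d * (1 + l) <= dm by rewrite -ler_pdivlMr// !ge_min lexx !orbT.
have d_gt0 : 0 < d by rewrite !lt_min d00 !divr_gt0.
have dld : d <= d * (1 + l) by rewrite ler_pMr//; lra.
exists d => // M u t x xp xm LM uu0 tt0 Mx Mxp Mxm.
have close (a : R) : `|a| = l -> enorm (u + a *: t - (u0 + a *: t0)) < d * (1 + l).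
  move=> al; have -> : u + a *: t - (u0 + a *: t0) = (u - u0) + a *: (t - t0).
    by apply/rowP => i; rewrite !mxE; ring.
  apply: le_lt_trans (enormD _ _) _; rewrite enormZ al mulrDr mulr1 ltrD// mulrC.
  by rewrite ltr_pM2r.
have x_q : enorm (x - q) < r / 2.
  by apply: h0 Mx; [exact: lt_le_trans dd0|exact: lt_le_trans dd0].
have xp_q : enorm (xp - q') < r / 2.
  apply: hp Mxp; first exact: lt_le_trans LM (le_trans dld _).
  by apply: lt_le_trans ddp; apply: close; rewrite gtr0_norm.
have xm_q : enorm (xm - q) < r / 2.
  apply: hm Mxm; first exact: lt_le_trans LM (le_trans dld _).
  apply: lt_le_trans ddm; rewrite -!scaleNr; apply: close.
  by rewrite normrN gtr0_norm.
split.
  have -> : xp - x - (q' - q) = (xp - q') - (x - q).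
    by apply/rowP => i; rewrite !mxE; ring.
  by rewrite [r]splitr (le_lt_trans (enormD _ _))// enormN ltrD.
by rewrite [r]splitr (le_lt_trans (enorm_dist_triangle q _ _))// (enorm_sym q) ltrD.
Qed.

(** Ahead of [u] the difference of support points changes by nearly [w], from the first body; behind
    it changes by nearly [- w'], from the second, whose jump is made in direction [- t0]. Both have
    positive product with [t]. *)
Lemma turn_perturb P (u0 : sphere R n) (t0 : tangent u0) e r :
  0 < e -> 0 < r -> exists2 Q, pair_dist P Q < r & exists2 d, 0 < d &
    forall Q' (u : sphere R n) (t : tangent u), pair_dist Q Q' < d ->
      enorm (\val u - \val u0) < d ->
      enorm (\val (\val t) - \val (\val t0)) < d ->
      turns_within (reverse_gauss Q'.1 Q'.2) e t.
Proof.
move=> e0 r0; have r40 : 0 < r / 4 by rewrite divr_gt0.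
have r4r : r / 4 + r / 4 < r by lra.
have [u1 t1 tu] := tangentP t0.
have t1N : enorm (- \val (\val t0)) = 1 by rewrite enormN.
have tuN : dot (- \val (\val t0)) (\val u0) = 0 by rewrite dotNl tu oppr0.
have [a a0 ha] := one_sided_jump P.1 u1 t1 tu r40.
have [b b0 hb] := one_sided_jump P.2 u1 t1N tuN r40.
(* Each body admits every [l] below its own threshold, so one [l] serves both bodies and both sides
   of [u]. *)
pose l := Num.min e (Num.min a b) / 2.
have m0 : 0 < Num.min e (Num.min a b) by rewrite !lt_min e0 a0 b0.
have l0 : 0 < l by rewrite divr_gt0.
have lm : l < Num.min e (Num.min a b) by rewrite ltr_pdivrMr// ltr_pMr// ltr1n.
move: (lm); rewrite !lt_min => /and3P[le la lb].
have [K [w [PK wt hK]]] := ha l (introT andP (conj l0 la)).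
have [L [w' [PL w't hL]]] := hb l (introT andP (conj l0 lb)).
exists (K, L : convex_body R n); first exact: le_lt_trans (lerD PK PL) r4r.
have [c c0 hc] := dot_gt0_stable wt.
have [c' c'0 hc'] := dot_gt0_stable w't.
(* Half of the tolerance goes to the body whose support point jumps, half to the one whose support
   point stays. *)
pose c2 := Num.min c c' / 2.
have c20 : 0 < c2 by rewrite divr_gt0// lt_min c0.
have c2c : c2 + c2 <= c by rewrite -splitr ge_min lexx.
have c2c' : c2 + c2 <= c' by rewrite -splitr ge_min lexx orbT.
have c2_le (d : R) : c2 + c2 <= d -> c2 <= d by apply: le_trans; rewrite lerDl ltW.
have [dK dK0 {}hK] := hK _ c20; have [dL dL0 {}hL] := hL _ c20.
exists (Num.min c2 (Num.min dK dL)); first by rewrite !lt_min c20 dK0 dL0.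
move=> Q' u t; rewrite !lt_min => /and3P[_ QK QL] /and3P[_ uK uL] /and3P[tc tK tL].
have {}QK : hausdorff_dist K Q'.1 < dK.
  by apply: le_lt_trans QK; rewrite lerDl hausdorff_dist_ge0.
have {}QL : hausdorff_dist L Q'.2 < dL.
  by apply: le_lt_trans QL; rewrite lerDr hausdorff_dist_ge0.
have [_ ut1 _] := tangentP t.
have tNE : enorm (- \val (\val t) - - \val (\val t0)) = enorm (\val (\val t) - \val (\val t0)).
  by rewrite -opprD enormN.
have boxN M : supports M (\val u - l *: \val (\val t)) (support_point M (boxplus t (- l))).
  by rewrite -scaleNr; exact: support_point_boxplus.
have boxNN M : supports M (\val u - l *: - \val (\val t)) (support_point M (boxplus t l)).
  by rewrite scalerN opprK; exact: support_point_boxplus.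
have boxPN M : supports M (\val u + l *: - \val (\val t)) (support_point M (boxplus t (- l))).
  by rewrite scalerN.
have [Kp Km] := hK Q'.1 _ _ _ _ _ QK uK tK (support_pointP _ _)
  (support_point_boxplus _ t l) (boxN _).
have [|Lp Lm] := hL Q'.2 _ (- \val (\val t)) _ _ _ QL uL _ (support_pointP _ _)
  (boxPN _) (boxNN _).
  by rewrite tNE.
exists l, l; split; [exact/andP|exact/andP|].
rewrite /reverse_gauss.
set xK := support_point Q'.1 u in Kp Km *; set xL := support_point Q'.2 u in Lp Lm *.
set xKp := support_point _ (boxplus t l) in Kp *.
set xLp := support_point Q'.2 (boxplus t l) in Lm *.
set xKm := support_point _ (boxplus t (- l)) in Km *.
set xLm := support_point Q'.2 (boxplus t (- l)) in Lp *.
apply: mulr_gt0.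
  apply: hc => //; last exact: lt_le_trans tc (c2_le _ c2c).
  have -> : xKp - xLp - (xK - xL) - w = (xKp - xK - w) - (xLp - xL).
    by apply/rowP => i; rewrite !mxE; ring.
  apply: lt_le_trans c2c; apply: le_lt_trans (enormD _ _) _.
  by rewrite enormN ltrD.
(* Both signs are flipped because [hc'] concerns products with vectors near [- t0]. *)
rewrite -[X in 0 < X]opprK -dotNl -dotNr.
apply: hc'; [|by rewrite tNE (lt_le_trans tc)// c2_le|by rewrite enormN].
have -> : - (xKm - xLm - (xK - xL)) - w' = (xLm - xL - w') - (xKm - xK).
  by apply/rowP => i; rewrite !mxE; ring.
apply: lt_le_trans c2c'; apply: le_lt_trans (enormD _ _) _.
by rewrite enormN ltrD.
Qed.

(** * Reduction to countably many conditions *)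

Definition rational_ball (i : 'rV[rat]_n * nat) : set 'rV[R]_n :=
  [set x | enorm (x - map_mx ratr i.1) < i.2.+1%:R^-1].

Lemma rational_ball_basis (x : 'rV[R]_n) e : 0 < e ->
  exists2 i, rational_ball i x & forall y, rational_ball i y -> enorm (y - x) < e.
Proof.
move=> e0; have e20 : 0 < e / 2 by rewrite divr_gt0.
pose k := Num.truncn (e / 2)^-1.
have k0 : 0 < k.+1%:R^-1 :> R by rewrite invr_gt0.
have ke : k.+1%:R^-1 < e / 2.
  by rewrite invf_plt ?posrE// Num.Theory.truncnS_gt.
pose d : R := k.+1%:R^-1 / (Num.sqrt n%:R + 1).
have c0 : 0 < Num.sqrt n%:R + 1 :> R by rewrite ltr_wpDl ?sqrtr_ge0.
have d0 : 0 < d by exact: divr_gt0.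
have rat_ex (i : 'I_n) : exists q : rat, `|x 0 i - ratr q| < d.
  have /rat_in_itvoo[q] : x 0 i - d < x 0 i + d by lra.
  rewrite in_itv /= => /andP[h1 h2]; exists q.
  by rewrite ltr_norml; apply/andP; split; lra.
have [q qP] := choice rat_ex.
have xq : rational_ball (\row_i q i, k) x.
  rewrite /rational_ball /=; apply: le_lt_trans (enorm_le_mx_norm _) _.
  have h : `|x - map_mx ratr (\row_i q i)| <= d.
    rewrite [leLHS]/Num.Def.normr /= mx_normrE; apply: bigmax_le => [|[i j] _]/=.
      exact: ltW.
    by rewrite (ord1 i) !mxE ltW.
  apply: le_lt_trans (ler_wpM2l (sqrtr_ge0 _) h) _.
  by rewrite /d mulrA ltr_pdivrMr// mulrC ltr_pM2l// ltrDl.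
exists (\row_i q i, k) => // y; move: xq; rewrite /rational_ball /= => xq yq.
have := enorm_dist_triangle (map_mx ratr (\row_i q i)) y x.
rewrite (enorm_sym (map_mx _ _) x) => h.
by apply: le_lt_trans h _; rewrite [ltRHS]splitr ltrD// (lt_trans _ ke).
Qed.

(** Project [t0] onto the hyperplane orthogonal to [u] and normalize: each step moves it by at most
    [|u - u0|], and the bound 1/2 keeps the projection away from 0. *)
Lemma tangent_stable (u0 : sphere R n) (t0 : tangent u0) r : 0 < r ->
  exists2 d, 0 < d & forall u : sphere R n, enorm (\val u - \val u0) < d ->
    exists t : tangent u, enorm (\val (\val t) - \val (\val t0)) < r.
Proof.
move=> r0; exists (Num.min 2^-1 (r / 2)); first by rewrite lt_min invr_gt0 ltr0n divr_gt0.
move=> u; rewrite lt_min => /andP[uu1 uur].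
have [_ t1 tu] := tangentP t0.
have u1 : enorm (\val u) = 1 := set_valP u.
set d := enorm _ in uu1 uur.
pose s := dot (\val (\val t0)) (\val u).
pose w := \val (\val t0) - s *: \val u.
have sd : `|s| <= d.
  have sE : s = dot (\val (\val t0)) (\val u - \val u0) by rewrite dotDr dotNr tu subr0.
  have := dot_le_enorm (\val (\val t0)) (\val u - \val u0).
  have := dot_le_enorm (\val (\val t0)) (- (\val u - \val u0)).
  by rewrite dotNr enormN -sE t1 mul1r -/d ler_norml => h1 h2; apply/andP; split; lra.
have wt : enorm (w - \val (\val t0)) <= d.
  by rewrite /w addrC addKr enormN enormZ u1 mulr1.
have wu : dot w (\val u) = 0.
  by rewrite /w dotDl dotNl dotZl -/s -sqr_enorm u1 expr1n mulr1 subrr.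
have w1 : `|1 - enorm w| <= d.
  have h1 := enormD (w - \val (\val t0)) (\val (\val t0)).
  have h2 := enormD (\val (\val t0) - w) w.
  move: h1 h2; rewrite !subrK t1 (enorm_sym _ w) => h1 h2.
  by rewrite ler_norml; apply/andP; split; lra.
have w0 : 0 < enorm w by move: w1; rewrite ler_norml => /andP[]; lra.
have v1 : enorm ((enorm w)^-1 *: w) = 1.
  by rewrite enormZ gtr0_norm ?invr_gt0// mulVf// gt_eqF.
have vu : dot ((enorm w)^-1 *: w) (\val u) = 0 by rewrite dotZl wu mulr0.
have [t tE] := tangent_ex v1 vu; exists t; rewrite tE.
have h : enorm ((enorm w)^-1 *: w - w) <= d.
  have -> : (enorm w)^-1 *: w - w = (1 - enorm w) *: ((enorm w)^-1 *: w).
    by rewrite scalerA mulrBl mul1r divff ?gt_eqF// scalerBl scale1r.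
  by rewrite enormZ v1 mulr1.
by have := enorm_dist_triangle w ((enorm w)^-1 *: w) (\val (\val t0)); lra.
Qed.

(** Tangent vectors at different base points are compared in the ambient space, so that one ball [j]
    serves all [u]. The premise exempts pairs of balls that contain no [(u, t)]. *)
Definition locally_turning P (i j : 'rV[rat]_n * nat) e :=
  (exists u : sphere R n, exists2 t : tangent u,
     rational_ball i (\val u) & rational_ball j (\val (\val t))) ->
  exists (u0 : sphere R n) (t0 : tangent u0), [/\ rational_ball i (\val u0),
    rational_ball j (\val (\val t0)) &
    exists2 d, 0 < d & forall (u : sphere R n) (t : tangent u),
      enorm (\val u - \val u0) < d ->
      enorm (\val (\val t) - \val (\val t0)) < d ->
      turns_within (reverse_gauss P.1 P.2) e t].

(** [turn_perturb] gives density, and its [d] bounds both the neighbourhood of pairs and that of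
    [(u, t)]. *)
Lemma most_locally_turning i j e : 0 < e ->
  most (fun P : body_pair R n => locally_turning P i j e).
Proof.
move=> e0; apply: most_dense_open => P N NP.
have [[u [t ui tj]]|nut] := pselect (exists u : sphere R n, exists2 t : tangent u,
    rational_ball i (\val u) & rational_ball j (\val (\val t))); last first.
  exists P; first exact: nbhs_singleton.
  by apply/nbhs_pairP; exists 1 => // Q _ /nut.
have [r r0 rN] := (nbhs_pairP _ _).1 NP.
have [Q PQ [d d0 Qd]] := turn_perturb P t e0 r0.
exists Q; first exact: rN.
apply/nbhs_pairP; exists d => // Q' QQ' _; exists u, t; split => //.
by exists d => // v s; exact: Qd.
Qed.

(** [pr] selects one body of the pair and [upd] replaces it, so that one proof covers both
    coordinates. *)
Lemma most_strictly_convex (pr : body_pair R n -> convex_body R n)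
    (upd : body_pair R n -> convex_body R n -> body_pair R n) :
  (forall P K, pr (upd P K) = K) ->
  (forall P K, pair_dist P (upd P K) = hausdorff_dist (pr P) K) ->
  (forall P Q, hausdorff_dist (pr P) (pr Q) <= pair_dist P Q) ->
  most (fun P => strictly_convex (pr P)).
Proof.
move=> updK updd prd.
suff : most (fun P => forall m : nat, exists2 r, 0 < r & rotund (pr P) m.+1%:R^-1 r).
  by apply: most_sub => P; exact: rotund_strictly_convex.
apply: most_forall => m; apply: most_dense_open => P N /nbhs_pairP[e e0 eN].
have e20 : 0 < e / 2 by rewrite divr_gt0.
have [L PL Lrot] := rotund_dense (pr P) e20.
have m0 : 0 < m.+1%:R^-1 :> R by rewrite invr_gt0.
(* [rotund_perturb] doubles the separation, so [L] is taken rotund at half of it. *)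
have m20 : 0 < m.+1%:R^-1 / 2 :> R by rewrite divr_gt0.
have [r r0 Lr] := Lrot _ m20.
have [d d0 Ld] := rotund_perturb m0 r0 Lr.
exists (upd P L).
  apply: eN; rewrite updd (le_lt_trans PL)// ltr_pdivrMr// ltr_pMr//.
  by rewrite ltr1n.
apply/nbhs_pairP; exists d => // Q LQ; exists (r / 2); first exact: divr_gt0.
by apply: Ld; apply: le_lt_trans LQ; rewrite -{1}(updK P L).
Qed.

Lemma locally_turning_most P :
  (forall i j (k : nat), locally_turning P i j k.+1%:R^-1) ->
  most (fun u : sphere R n => most (fun t : tangent u =>
    makes_turn (reverse_gauss P.1 P.2) t)).
Proof.
move=> hP.
(* If [u] is [good] for all [j], turning at scale [k] holds on a set with dense interior in
   [tangent u]. *)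
pose good (jk : ('rV[rat]_n * nat) * nat) (u : sphere R n) :=
  (exists t : tangent u, rational_ball jk.1 (\val (\val t))) ->
  exists2 t : tangent u, rational_ball jk.1 (\val (\val t)) &
    nbhs t [set s | turns_within (reverse_gauss P.1 P.2) jk.2.+1%:R^-1 s].
suff : most (fun u : sphere R n => forall jk, good jk u).
  apply: most_sub => u gu.
  suff : most (fun t : tangent u => forall k : nat,
      turns_within (reverse_gauss P.1 P.2) k.+1%:R^-1 t).
    apply: most_sub => t ht e e0.
    have [l [m [/andP[l0 le] /andP[m0 me] lm]]] := ht (Num.truncn e^-1).
    have ke : (Num.truncn e^-1).+1%:R^-1 < e :> R.
      by rewrite invf_plt ?posrE// Num.Theory.truncnS_gt.
    exists l, m; split => //; first by rewrite l0 (lt_trans le).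
    by rewrite m0 (lt_trans me).
  apply: most_forall => k; apply: most_dense_open => t N /nbhs_tangentP[e e0 eN].
  have [j jt je] := rational_ball_basis (\val (\val t)) e0.
  have [|s js sk] := gu (j, k); first by exists t.
  by exists s => //; apply: eN; exact: je.
apply: most_forall => -[j k]; apply: most_dense_open => u N /nbhs_sphereP[e e0 eN].
(* If no base point near [u] has a tangent vector in ball [j], then [good] holds vacuously near
   [u]. *)
have [[v [t vu jt]]|nv] := pselect (exists v : sphere R n, exists2 t : tangent v,
    enorm (\val v - \val u) < e & rational_ball j (\val (\val t))); last first.
  exists u; first by apply: eN; rewrite subrr enorm0.
  apply/nbhs_sphereP; exists e => // v vu [t jt]; exfalso; apply: nv.
  by exists v, t.
have ve0 : 0 < e - enorm (\val v - \val u) by rewrite subr_gt0.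
have [i iv ie] := rational_ball_basis (\val v) ve0.
have [|u0 [t0 [iu0 jt0 [d d0 hd]]]] := hP i j k; first by exists v, t.
exists u0.
  apply: eN; have := ie _ iu0.
  by have := enorm_dist_triangle (\val v) (\val u0) (\val u); lra.
have [r r0 rj] : exists2 r, 0 < r & forall y, enorm (y - \val (\val t0)) < r ->
    rational_ball j y.
  exists (j.2.+1%:R^-1 - enorm (\val (\val t0) - map_mx ratr j.1)).
    by rewrite subr_gt0.
  move=> y yt; rewrite /rational_ball /=.
  rewrite ltrBrDr in yt; apply: le_lt_trans yt.
  exact: enorm_dist_triangle.
have rd0 : 0 < Num.min r d by rewrite lt_min r0.
(* Each [w] near [u0] needs a tangent vector of its own, close enough to [t0] to stay in ball [j]
   and in the region of turns. *)
have [d' d'0 hd'] := tangent_stable t0 rd0.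
apply/nbhs_sphereP; exists (Num.min d d'); first by rewrite lt_min d0.
move=> w; rewrite lt_min => /andP[wd wd'] _.
have [s] := hd' w wd'; rewrite lt_min => /andP[sr sd].
exists s; first exact: rj.
apply/nbhs_tangentP; exists (d - enorm (\val (\val s) - \val (\val t0))).
  by rewrite subr_gt0.
move=> s' s's; apply: hd => //.
by have := enorm_dist_triangle (\val (\val s)) (\val (\val s')) (\val (\val t0)); lra.
Qed.

End turning_pairs.

(** * Assembly of the generic properties *)

Theorem theorem1 (R : realType) (n : nat) (hn : (2 <= n)%N) :
  most (fun KL : body_pair R n =>
    [/\ strictly_convex KL.1, strictly_convex KL.2 &
      most (fun u : sphere R n =>
        most (fun t : tangent u =>
          makes_turn (reverse_gauss KL.1 KL.2) t))]).
Proof.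
have m1 : most (fun KL : body_pair R n => strictly_convex KL.1).
  apply: (@most_strictly_convex R n fst (fun P K => (K, P.2))) => //= P Q.
    by rewrite /pair_dist /= hausdorff_distxx addr0.
  by rewrite /pair_dist lerDl hausdorff_dist_ge0.
have m2 : most (fun KL : body_pair R n => strictly_convex KL.2).
  apply: (@most_strictly_convex R n snd (fun P K => (P.1, K))) => //= P Q.
    by rewrite /pair_dist /= hausdorff_distxx add0r.
  by rewrite /pair_dist lerDr hausdorff_dist_ge0.
have m3 : most (fun KL : body_pair R n =>
    forall ijk : ('rV[rat]_n * nat) * ('rV[rat]_n * nat) * nat,
      locally_turning KL ijk.1.1 ijk.1.2 ijk.2.+1%:R^-1).
  apply: most_forall => ijk; apply: most_locally_turning.
  by rewrite invr_gt0.
apply: most_sub (most_and m1 (most_and m2 m3)) => KL [sK [sL turn]].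
by split => //; apply: locally_turning_most => i j k; exact: (turn (i, j, k)).
Qed.
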